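(* Let $G$ be a simple undirected graph and let $H$ be any subgraph of $G$ (not necessarily induced). Then $\mathcal{E}(G)\ge 2R(H)$, with equality if and only if $G$ is a union of complete bipartite graphs and $R(H)=R(G)$.
   Context: If $\lambda_1,\dots,\lambda_n$ are the eigenvalues of the adjacency matrix of $G$, the energy of $G$ is $\mathcal{E}(G)=\sum_{k=1}^n|\lambda_k|$. The Randić index of a graph $H$ is $R(H)=\sum_{(i,j)\in E(H)}\frac{1}{\sqrt{\deg_H(i)\deg_H(j)}}$, where $\deg_H$ denotes the degree in $H$ and each edge is counted once. *)

(* Defs.v *)
From HB Require Import structures.
From mathcomp Require Import all_boot all_order all_algebra.

Set Implicit Arguments.
Unset Strict Implicit.
Unset Printing Implicit Defensive.

Import Order.TTheory GRing.Theory Num.Theory.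
Local Open Scope ring_scope.

(* Vertices are drawn from an ambient finite type so that a graph and its
   subgraphs have the same type; the vertex set of G is [vset G], not T. *)
Record graph (T : finType) := Graph {
  vset : {set T};
  eset : {set {set T}};
  _ : [forall E in eset, (#|E| == 2%N) && (E \subset vset)]
}.

Section Graphs.
Variable T : finType.
Implicit Types G H : graph T.

Definition subgraph H G : Prop :=
  vset H \subset vset G /\ eset H \subset eset G.

Definition adj G : rel T := fun x y => [set x; y] \in eset G.

Definition deg G (x : T) : nat := #|[set y | adj G x y]|.

(* One of the two parts may be empty, so that a single vertex K_1 = K_{1,0}
   is complete bipartite and unions of complete bipartite graphs may have
   isolated vertices. *)
Definition complete_bipartite G : Prop :=
  exists A B : {set T},
    [/\ A :|: B = vset G, [disjoint A & B]
      & eset G = [set [set x; y] | x in A, y in B]].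

Definition is_disjoint_union G (k : nat) (F : 'I_k -> graph T) : Prop :=
  [/\ forall i j, i != j -> [disjoint vset (F i) & vset (F j)],
      vset G = \bigcup_i vset (F i)
    & eset G = \bigcup_i eset (F i)].

Definition union_of_complete_bipartite G : Prop :=
  exists (k : nat) (F : 'I_k -> graph T),
    is_disjoint_union G F /\ forall i, complete_bipartite (F i).

End Graphs.

Section Spectrum.
Variable C : numClosedFieldType.

(* C generalizes the complex numbers; energies and Randic indices are real
   elements of C, on which its partial order is the usual one. *)

(* Eigenvalues listed with multiplicity, in an unspecified order. *)
Definition eigenvalues n (M : 'M[C]_n) : seq C :=
  sval (closed_field_poly_normal (char_poly M)).

Lemma char_poly_eigenvalues n (M : 'M[C]_n) :
  char_poly M = \prod_(z <- eigenvalues M) ('X - z%:P).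
Proof.
rewrite /eigenvalues; case: closed_field_poly_normal => s /= {1}->.
by rewrite (monicP (char_poly_monic M)) scale1r.
Qed.

Variable T : finType.

Definition adjmx (G : graph T) : 'M[C]_(#|vset G|) :=
  \matrix_(i, j) (adj G (enum_val i) (enum_val j))%:R.

Definition energy (G : graph T) : C := \sum_(z <- eigenvalues (adjmx G)) `|z|.

(* For an edge E = {i, j} the product under the root is deg i * deg j. *)
Definition randic (H : graph T) : C :=
  \sum_(E in eset H) 1 / sqrtC (\prod_(x in E) (deg H x)%:R).

End Spectrum.

(* Main.v *)
Require Import Defs.
From HB Require Import structures.
From mathcomp Require Import all_boot all_order all_algebra.
From mathcomp Require Import ring.

Set Implicit Arguments.
Unset Strict Implicit.
Unset Printing Implicit Defensive.

Import Order.TTheory GRing.Theory Num.Theory.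
Local Open Scope ring_scope.

(* Let A be the adjacency matrix of G and S = |A|, so that the energy is the
   trace of S.  For an edge xy the vectors u = e_x / sqrt(deg_H x) and
   v = e_y / sqrt(deg_H y) satisfy <Su,u> + <Sv,v> >= 2 <Au,v>.  Summing over
   the edges of H, where each vertex distributes S_xx evenly over its H-edges,
   gives the inequality.

   Equality forces Au = Sv for every edge of H and S_xx = 0 at the vertices
   isolated in H.  Comparing entries, if y'y is an edge of H and yz one of G
   then S_y'y' = S_y'z = S_zz, hence A e_y' = A e_z and N_G(y') = N_G(z).  It
   follows that the ends of a walk of length 3 in G are adjacent, which means
   that G is a union of complete bipartite graphs.

   Conversely, for such a G with degree matrix D one has A D^-1 A D^-1 A = A.
   For a unit eigenvector p of eigenvalue l this gives l = <Aw,w> with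
   w = l D^-1 p, and bounding |l| by AM-GM on each edge and summing over an
   orthonormal eigenbasis yields E(G) <= 2 R(G). *)

(** * Closure under walks of length 3 and unions of complete bipartite graphs *)

Section Combinatorics.
Variable T : finType.
Implicit Types (G : graph T) (x y z w : T).

Definition neigh G x : {set T} := [set y | adj G x y].

Lemma adj_sym G x y : adj G x y = adj G y x.
Proof. by rewrite /adj setUC. Qed.

Lemma adjP G x y : adj G x y -> [/\ x != y, x \in vset G & y \in vset G].
Proof.
case: G => V E GP; rewrite /adj /= => xyE.
move/forallP/(_ [set x; y])/implyP/(_ xyE): GP; rewrite cards2 subUset !sub1set.
by case: (x != y) => //= /andP[-> ->].
Qed.

Lemma adj_irr G x : adj G x x = false.
Proof. by apply/negP => /adjP[]; rewrite eqxx. Qed.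

Lemma edgeP G (E : {set T}) :
  E \in eset G -> exists x y, E = [set x; y] /\ adj G x y.
Proof.
case: G => V F GP; rewrite /adj /= => EF.
move/forallP/(_ E)/implyP/(_ EF)/andP: GP => [/cards2P[x [y [_ defE]]] _].
by exists x, y; rewrite -defE.
Qed.

(* In a simple graph this says exactly that every component is complete
   bipartite. *)
Definition walk3_closed G :=
  forall x y z w, adj G x y -> adj G y z -> adj G z w -> adj G x w.

(** Consecutive edges share a vertex, so a walk stays in one block; three changes of side then end
    on the side opposite to the start. *)
Lemma union_walk3_closed G : union_of_complete_bipartite G -> walk3_closed G.
Proof.
move=> [k [F [[disjF _ eG] cbF]]].
have adjF x y : adj G x y -> exists i, adj (F i) x y.
  by rewrite /adj eG => /bigcupP[i _ xyi]; exists i.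
have sameF i j x : x \in vset (F i) -> x \in vset (F j) -> i = j.
  move=> xi xj; apply/eqP; apply: contraT => /disjF /disjoint_setI0 /setP/(_ x).
  by rewrite !inE xi xj.
move=> x y z w /adjF[i xy] /adjF[j yz] /adjF[l zw].
have [_ xi yi] := adjP xy; have [_ yj zj] := adjP yz.
have [_ zl wl] := adjP zw.
have ij := sameF _ _ _ yi yj; have jl := sameF _ _ _ zj zl; subst j l.
suff: adj (F i) x w by rewrite /adj eG => xw; apply/bigcupP; exists i.
have [A [B [_ dAB eF]]] := cbF i.
have adjE u v : adj (F i) u v =
    ((u \in A) && (v \in B)) || ((u \in B) && (v \in A)).
  rewrite /adj eF; apply/imset2P/idP => [[a b aA bB] uv|].
    have: (u \in [set a; b]) && (v \in [set a; b]) by rewrite -uv !inE !eqxx orbT.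
    have: (a \in [set u; v]) && (b \in [set u; v]) by rewrite uv !inE !eqxx orbT.
    have ab : a != b by apply: contraTneq aA => ->; rewrite (disjointFl dAB bB).
    rewrite !inE => /andP[/orP[]/eqP au /orP[]/eqP bv] _; subst;
      by rewrite ?eqxx in ab *; rewrite ?aA ?bB ?orbT.
  by case/orP=> /andP[uA vB]; [exists u v|exists v u] => //; rewrite setUC.
have AB u : (u \in A) && (u \in B) = false.
  by apply/negP => /andP[uA]; rewrite (disjointFr dAB uA).
move: xy yz zw; rewrite !adjE.
move: (AB y) (AB z) (AB x) (AB w).
by do 8 case: (_ \in _).
Qed.

Lemma walk3_closed_neigh G x y z :
  walk3_closed G -> adj G x y -> adj G y z -> neigh G x = neigh G z.
Proof.
move=> wG xy yz; apply/setP => w; rewrite !inE.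
apply/idP/idP => [xw|]; last exact: wG xy yz.
by apply: wG xw; [rewrite adj_sym; apply: yz|rewrite adj_sym].
Qed.

Lemma walk3_closed_deg G x y z :
  walk3_closed G -> adj G x y -> adj G y z -> deg G x = deg G z.
Proof. by move=> wG xy yz; congr #|pred_of_set _|; apply: walk3_closed_neigh yz. Qed.

(** Closing the walk around a triangle would give a loop. *)
Lemma walk3_closed_no_triangle G x y z :
  walk3_closed G -> adj G x y -> adj G y z -> adj G x z = false.
Proof.
move=> wG xy yz; apply/negP; rewrite adj_sym => zx.
by have := wG _ _ _ _ xy yz zx; rewrite adj_irr.
Qed.

(* For a 3-walk closed graph this is the vertex set of the component of [x],
   except that all isolated vertices share the label [set0]. *)
Definition label G x := neigh G x :|: \bigcup_(y in neigh G x) neigh G y.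

Lemma label_adj G x y : walk3_closed G -> adj G x y ->
  label G x = neigh G x :|: neigh G y.
Proof.
move=> wG xy; rewrite /label; congr (_ :|: _); apply/setP => z.
apply/bigcupP/idP => [[u]|zy]; last by exists y; rewrite // inE.
rewrite inE => xu zu; rewrite (walk3_closed_neigh (y := x) (z := u) wG) //.
by rewrite adj_sym.
Qed.

Lemma eq_label_adj G x y : walk3_closed G -> adj G x y -> label G x = label G y.
Proof.
move=> wG xy; have yx := xy; rewrite adj_sym in yx.
by rewrite (label_adj wG xy) (label_adj wG yx) setUC.
Qed.

Definition block_edges G (V : {set T}) := [set E in eset G | E \subset V].

Lemma block_graph_subproof G V : [forall E in block_edges G V,
  (#|E| == 2%N) && (E \subset V)].
Proof.
apply/forallP => E; apply/implyP; rewrite inE => /andP[/edgeP[x [y [-> xy]]] ->].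
by rewrite cards2; have [-> _ _] := adjP xy.
Qed.

Definition block_graph G V := Graph (block_graph_subproof G V).

(** If some edge [xy] meets the block, the parts are the neighbourhoods of [x] and [y], whose union
    is the label. A block without edges has one empty part. *)
Lemma block_graph_complete_bipartite G (L : {set T}) : walk3_closed G ->
  complete_bipartite (block_graph G [set x in vset G | label G x == L]).
Proof.
move=> wG; set V := [set x in vset G | _].
have VP x y : adj G x y -> x \in V -> y \in V.
  move=> xy; rewrite !inE => /andP[_ /eqP<-]; rewrite (eq_label_adj wG xy) eqxx.
  by have [_ _ ->] := adjP xy.
case: (pickP (mem [set x in V | neigh G x != set0])) => [x|none]; last first.
  exists V, set0; split => //=; first by rewrite setU0.
    by rewrite -setI_eq0 setI0.
  apply/setP => E; apply/idP/imset2P => [|[? ? _]]; last by rewrite inE.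
  rewrite inE => /andP[/edgeP[x [y [-> xy]]]]; rewrite subUset !sub1set => /andP[xV _].
  have := none x; rewrite /= inE xV /= => /negbT/negPn/eqP/setP/(_ y).
  by rewrite !inE xy.
rewrite /= inE => /andP[xV /set0Pn[y]]; rewrite inE => xy.
have yx := xy; rewrite adj_sym in yx.
have yV := VP _ _ xy xV.
have defL : L = neigh G x :|: neigh G y.
  by rewrite -(label_adj wG xy); move: xV; rewrite !inE => /andP[_ /eqP].
exists (neigh G x), (neigh G y); split.
- apply/setP => u; rewrite /= inE; apply/orP/idP => [[]|uV].
  + by rewrite inE => /VP; apply.
  + by rewrite inE => /VP; apply.
  apply/orP; rewrite -in_setU -defL.
  move: (uV); rewrite inE => /andP[_ /eqP uL].
  case: (set_0Vmem (neigh G u)) => [u0|[v]].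
    have : y \in label G u by rewrite uL defL !inE xy.
    rewrite /label u0 set0U => /bigcupP[v]; by rewrite inE.
  rewrite inE => uv; rewrite -uL (label_adj wG uv) !inE orbC.
  by rewrite adj_sym uv.
- rewrite -setI_eq0; apply/eqP/setP => u; rewrite !inE.
  by apply/negP => /andP[xu yu]; rewrite (walk3_closed_no_triangle wG xy yu) in xu.
apply/setP => E; rewrite inE; apply/idP/imset2P => [/andP[]|[a b]].
  case/edgeP => a [b [-> ab]]; rewrite subUset !sub1set => /andP[aV bV].
  have : a \in L.
    move: (aV); rewrite inE => /andP[_ /eqP<-].
    by rewrite (label_adj wG ab) !inE [adj G b a]adj_sym ab orbT.
  rewrite defL !inE => /orP[xa|ya].
    exists a b; rewrite ?inE //; exact: wG yx xa ab.
  exists b a; rewrite ?inE //; last by rewrite setUC.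
  exact: wG xy ya ab.
rewrite !inE => xa yb ->; rewrite subUset !sub1set; apply/andP; split.
  by rewrite -/(adj G a b) (wG _ _ _ _ _ xy yb) // adj_sym.
by rewrite (VP x a) ?(VP y b).
Qed.

Lemma walk3_closed_union G : walk3_closed G -> union_of_complete_bipartite G.
Proof.
move=> wG.
(* There is one block per subset of [T]; subsets that are not labels give empty blocks. *)
pose V (i : 'I_#|{set T}|) := [set x in vset G | label G x == enum_val i].
exists _, (fun i => block_graph G (V i)); split; last first.
  by move=> i; apply: block_graph_complete_bipartite.
have xV x : x \in vset G -> x \in V (enum_rank (label G x)).
  by rewrite inE enum_rankK eqxx => ->.
split => /= [i j ij||].
- rewrite -setI_eq0; apply/eqP/setP => x; rewrite !inE.
  apply/negP => /andP[/andP[_ /eqP->] /andP[_ /eqP/enum_val_inj eij]].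
  by rewrite eij eqxx in ij.
- apply/setP => x; apply/idP/bigcupP => [xG|[i _]]; last by rewrite inE => /andP[].
  by exists (enum_rank (label G x)); rewrite ?xV.
apply/setP => E; apply/idP/bigcupP => [EG|[i _]]; last by rewrite inE => /andP[].
have [x [y [defE xy]]] := edgeP EG; have [_ xG yG] := adjP xy.
exists (enum_rank (label G x)) => //; rewrite inE EG defE subUset !sub1set xV //=.
by rewrite (eq_label_adj wG xy) xV.
Qed.

End Combinatorics.

(** * Spectral decomposition of the adjacency matrix *)

Lemma char_poly_conj (R : comUnitRingType) n (P M : 'M[R]_n) :
  P \in unitmx -> char_poly (invmx P *m M *m P) = char_poly M.
Proof.
move=> uP; pose Q := map_mx (@polyC R) P; pose Q' := map_mx (@polyC R) (invmx P).
have QQ' : Q' *m Q = 1%:M by rewrite -map_mxM mulVmx // map_mx1.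
have defM : char_poly_mx (invmx P *m M *m P) = Q' *m char_poly_mx M *m Q.
  rewrite /char_poly_mx !map_mxM -/Q -/Q' mulmxBr mulmxBl; congr (_ - _).
  by rewrite mul_mx_scalar -scalemxAl QQ' scalemx1.
rewrite /char_poly defM !det_mulmx mulrC mulrA -det_mulmx.
by rewrite (mulmx1C QQ') det1 mul1r.
Qed.

Section Spectral.
Variables (C : numClosedFieldType) (T : finType).
Implicit Types (G H : graph T) (x y z w : T).

Local Notation a G x y := ((adj G x y)%:R : C).

Lemma perm_eigenvalues n (M : 'M[C]_n) (P : 'M[C]_n) (d : 'rV[C]_n) :
    P \in unitmx -> M = invmx P *m diag_mx d *m P ->
  perm_eq (eigenvalues M) [seq d 0 i | i : 'I_n].
Proof.
move=> uP defM; apply: prod_XsubC_eq.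
rewrite -char_poly_eigenvalues defM char_poly_conj // char_poly_trig ?diag_mx_is_trig //.
by rewrite big_map big_enum; apply: eq_bigr => i _; rewrite mxE eqxx.
Qed.

(* The eigenvectors [p i] are extended by zero outside [vset G]. *)
Lemma adj_spectral G : exists (n : nat) (l : 'I_n -> C) (p : 'I_n -> T -> C),
  [/\ energy C G = \sum_i `|l i|,
      forall i, l i \is Num.real,
      forall x y, a G x y = \sum_i l i * (p i x)^* * p i y,
      forall i, \sum_x `|p i x| ^+ 2 = 1
    & forall i x, \sum_y a G x y * p i y = l i * p i x].
Proof.
pose M := adjmx C G; pose P := spectralmx M; pose d := spectral_diag M.
have Msym : M \is symmetricmx.
  apply/is_hermitianmxP; rewrite expr0 scale1r.
  by apply/matrixP => i j; rewrite !mxE adj_sym.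
have Mreal : M \is a mxOver Num.real.
  by apply/mxOverP => i j; rewrite mxE realn.
have uP : P \is unitarymx by apply: spectral_unitarymx.
have defM : M = invmx P *m diag_mx d *m P.
  exact/orthomx_spectralP/symmetric_normalmx.
pose v (j : 'I_#|vset G|) : T := enum_val j.
pose p i x := \sum_j (v j == x)%:R * P i j.
have pv i j : p i (v j) = P i j.
  rewrite /p (bigD1 j) //= eqxx mul1r big1 ?addr0 // => k /negPf kj.
  by rewrite (inj_eq enum_val_inj) kj mul0r.
have p0 i x : x \notin vset G -> p i x = 0.
  move=> xG; apply: big1 => j _; case: eqP => [vx|_]; last by rewrite mul0r.
  by rewrite -vx enum_valP in xG.
have sump i F : \sum_x F x * p i x = \sum_j F (v j) * P i j.
  rewrite (bigID (mem (vset G))) /= [X in _ + X]big1 ?addr0; last first.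
    by move=> x /p0->; rewrite mulr0.
  by rewrite big_enum_val; apply: eq_bigr => j _; rewrite -/(v j) pv.
have defP' : invmx P = map_mx Num.conj P^T by exact: invmx_unitary.
have ME i j : M i j = \sum_k d 0 k * (P k i)^* * P k j.
  rewrite {1}defM defP' mxE; apply: eq_bigr => k _.
  by rewrite mul_mx_diag !mxE [_^* * _]mulrC.
(* The rows of [P] are left eigenvectors; symmetry of the adjacency relation turns them into right
   ones below. *)
have PM : P *m M = diag_mx d *m P.
  by rewrite {1}defM !mulmxA mulmxV ?mul1mx // unitarymx_unit.
have adjv i j : a G (v i) (v j) = M i j by rewrite mxE.
exists _, (fun i => d 0 i), p; split.
- rewrite /energy (perm_big _ (perm_eigenvalues (unitarymx_unit uP) defM)).
  by rewrite big_map big_enum.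
- move=> i; have /mxOverP := hermitian_spectral_diag_real (realsym_hermsym Msym Mreal).
  by apply.
- move=> x y; have [xG|xG] := boolP (x \in vset G); last first.
    have /negPf-> : ~~ adj G x y by apply: contra xG => /adjP[].
    by rewrite big1 // => i _; rewrite p0 // conjC0 mulr0 mul0r.
  have [yG|yG] := boolP (y \in vset G); last first.
    have /negPf-> : ~~ adj G x y by apply: contra yG => /adjP[].
    by rewrite big1 // => i _; rewrite [p i y]p0 // mulr0.
  have [i _ ->] : exists2 i, true & x = v i.
    by exists (enum_rank_in xG x); rewrite // /v enum_rankK_in.
  have [j _ ->] : exists2 j, true & y = v j.
    by exists (enum_rank_in yG y); rewrite // /v enum_rankK_in.
  by rewrite adjv ME; apply: eq_bigr => k _; rewrite !pv.
- move=> i; under eq_bigr do rewrite normCKC.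
  rewrite sump; under eq_bigr do rewrite pv mulrC.
  have /unitarymxP/matrixP/(_ i i) := uP; rewrite !mxE eqxx mulr1n => <-.
  by apply: eq_bigr => j _; rewrite !mxE.
move=> i x; rewrite sump; have [xG|xG] := boolP (x \in vset G); last first.
  rewrite p0 // mulr0 big1 // => j _.
  have /negPf-> : ~~ adj G x (v j) by apply: contra xG => /adjP[].
  by rewrite mul0r.
have [j _ ->] : exists2 j, true & x = v j.
  by exists (enum_rank_in xG x); rewrite // /v enum_rankK_in.
rewrite pv; have /matrixP/(_ i j) := PM; rewrite mul_diag_mx !mxE => <-.
by apply: eq_bigr => k _; rewrite mxE mulrC [adj G _ _]adj_sym.
Qed.

End Spectral.

(** * Degree weights and sums over edges *)

Section Energy.
Variables (C : numClosedFieldType) (T : finType).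
Implicit Types (G H : graph T) (x y z w : T).

Local Notation a G x y := ((adj G x y)%:R : C).

(* Equal to [0] at isolated vertices, since [0^-1 = 0]. *)
Definition isqrt_deg H x : C := (sqrtC (deg H x)%:R)^-1.
Local Notation r := isqrt_deg.

Lemma isqrt_deg_ge0 H x : 0 <= r H x.
Proof. by rewrite invr_ge0 sqrtC_ge0 ler0n. Qed.

Lemma isqrt_deg_real H x : (r H x)^* = r H x.
Proof. exact/conj_Creal/ger0_real/isqrt_deg_ge0. Qed.

Lemma sqr_isqrt_deg H x : r H x ^+ 2 = (deg H x)%:R^-1.
Proof. by rewrite exprVn sqrtCK. Qed.

Lemma deg_gt0 H x y : adj H x y -> (0 < deg H x)%N.
Proof. by move=> xy; apply/card_gt0P; exists y; rewrite inE. Qed.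

Lemma isqrt_deg_gt0 H x y : adj H x y -> 0 < r H x.
Proof. by move=> xy; rewrite invr_gt0 sqrtC_gt0 ltr0n (deg_gt0 xy). Qed.

Lemma degE H x : (deg H x)%:R = \sum_y a H x y.
Proof.
by rewrite /deg -sum1_card natr_sum big_mkcond; apply: eq_bigr => y _; rewrite inE; case: adj.
Qed.

(** Each edge comes from exactly two ordered pairs, whence the factor 2. *)
Lemma sum_edges H (F : {set T} -> C) :
  2 * \sum_(E in eset H) F E = \sum_x \sum_y a H x y * F [set x; y].
Proof.
transitivity (\sum_x \sum_(y | adj H x y) F [set x; y]); last first.
  apply: eq_bigr => x _; rewrite big_mkcond; apply: eq_bigr => y _.
  by case: adj; rewrite ?mul1r ?mul0r.
rewrite pair_big_dep /= (partition_big (fun p => [set p.1; p.2]) (mem (eset H))) //=.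
rewrite mulr_sumr; apply: eq_bigr => E EH.
have [u [v [defE uv]]] := edgeP EH; have [neq_uv _ _] := adjP uv.
rewrite (eq_bigl (mem [set (u, v); (v, u)])) => [|[x y] /=]; last first.
  rewrite !inE !xpair_eqE /=; apply/andP/orP => [[xy /eqP exy]|]; last first.
    by case=> /andP[/eqP-> /eqP->]; rewrite defE ?[adj H v u]adj_sym ?[[set v; u]]setUC.
  have [neq_xy _ _] := adjP xy.
  have: (x \in E) && (y \in E) by rewrite -exy !inE !eqxx orbT.
  rewrite defE !inE => /andP[/orP[]/eqP ex /orP[]/eqP ey]; subst x y;
    by move: neq_xy; rewrite ?eqxx; auto.
rewrite big_setU1 ?big_set1 /=; last by rewrite inE xpair_eqE (negPf neq_uv).
by rewrite [[set v; u]]setUC -defE -mulr2n mulr_natl.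
Qed.

Lemma randicE H : 2 * randic C H = \sum_x \sum_y a H x y * (r H x * r H y).
Proof.
rewrite /randic sum_edges; apply: eq_bigr => x _; apply: eq_bigr => y _.
case xy: (adj H x y); rewrite ?mul0r // !mul1r.
have [neq_xy _ _] := adjP xy.
by rewrite big_setU1 ?big_set1 ?inE // sqrtCM ?invfM // nnegrE ler0n.
Qed.

Lemma sum_adj_sym H (f g : T -> C) :
    \sum_x \sum_y a H x y * (f x * g y) = \sum_x \sum_y a H x y * (g x * f y).
Proof.
rewrite exchange_big; apply: eq_bigr => x _; apply: eq_bigr => y _.
by rewrite adj_sym [g x * _]mulrC.
Qed.

(* For [l = 0] the left-hand side is [0] because [0^-1 = 0]. *)
Lemma sqr_sign_diff (l u v : C) : l \is Num.real ->
  `|l * u - `|l| * v| ^+ 2 / `|l| =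
  `|l| * (`|u| ^+ 2 + `|v| ^+ 2) - (l * u^* * v + l * v^* * u).
Proof.
have [->|l0] := eqVneq l 0; first by rewrite normr0 invr0 !(mulr0, mul0r) addr0 subr0.
move=> lR; have nl0 : `|l| != 0 by rewrite normr_eq0.
have ll : l * l = `|l| * `|l| by rewrite -!expr2 real_normK.
rewrite !normCK rmorphB !rmorphM /= (conj_Creal lR) (conj_normC l).
apply: (mulIf nl0); rewrite mulfVK //.
transitivity (l * l * (u * u^*) + `|l| * `|l| * (v * v^*)
   - `|l| * (l * u^* * v + l * v^* * u)); first by ring.
by rewrite ll; ring.
Qed.

(** * The lower bound as an exact identity *)

Section Decomposition.
Variables (G H : graph T) (n : nat) (l : 'I_n -> C) (p : 'I_n -> T -> C).
Hypotheses (subHG : subgraph H G) (lR : forall i, l i \is Num.real).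
Hypothesis EG : energy C G = \sum_i `|l i|.
Hypothesis aG : forall x y, a G x y = \sum_i l i * (p i x)^* * p i y.
Hypothesis p1 : forall i, \sum_x `|p i x| ^+ 2 = 1.
Hypothesis eigp : forall i x, \sum_y a G x y * p i y = l i * p i x.

(* The matrix |A| for the adjacency matrix A of [G]. *)
Definition absmx x y : C := \sum_i `|l i| * (p i x)^* * p i y.

Lemma absmx_diag x : absmx x x = \sum_i `|l i| * `|p i x| ^+ 2.
Proof. by apply: eq_bigr => i _; rewrite normCKC mulrA. Qed.

Lemma absmx_ge0 x : 0 <= absmx x x.
Proof. by rewrite absmx_diag sumr_ge0 // => i _; rewrite mulr_ge0 ?exprn_ge0. Qed.

Lemma absmx_conj x y : (absmx x y)^* = absmx y x.
Proof.
rewrite rmorph_sum; apply: eq_bigr => i _.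
by rewrite !rmorphM /= conjCK conj_normC mulrAC.
Qed.

Lemma energy_absmx : energy C G = \sum_x absmx x x.
Proof.
under eq_bigr do rewrite absmx_diag.
by rewrite exchange_big EG; apply: eq_bigr => i _; rewrite -mulr_sumr p1 mulr1.
Qed.

(** This is <Su,u> + <Sv,v> - 2<Au,v> for the vectors u, v of the pair, written in the eigenbasis as
    the squared norm of Au - Sv with weights 1/|l|, so that it is visibly nonnegative. *)
Definition edge_gap x y : C :=
  \sum_i `|l i * (p i x * r H x) - `|l i| * (p i y * r H y)| ^+ 2 / `|l i|.

Lemma edge_gap_term_ge0 x y i :
  0 <= `|l i * (p i x * r H x) - `|l i| * (p i y * r H y)| ^+ 2 / `|l i|.
Proof. by rewrite mulr_ge0 ?exprn_ge0 ?invr_ge0. Qed.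

Lemma edge_gapE x y : adj H x y ->
  edge_gap x y = absmx x x * r H x ^+ 2 + absmx y y * r H y ^+ 2
                 - 2 * (r H x * r H y).
Proof.
move=> xy; have xyG : adj G x y by move: xy; apply: (subsetP subHG.2).
transitivity (absmx x x * r H x ^+ 2 + absmx y y * r H y ^+ 2
              - (a G x y + a G y x) * (r H x * r H y)); last first.
  by rewrite [adj G y x]adj_sym xyG -natrD.
rewrite !absmx_diag !aG -big_split /= !mulr_suml -big_split -sumrB /=.
apply: eq_bigr => i _; rewrite sqr_sign_diff // !normrM !rmorphM /= !isqrt_deg_real.
rewrite !(ger0_norm (isqrt_deg_ge0 _ _)); ring.
Qed.

(** Both terms on the right are nonnegative, which gives the bound and, at equality, their
    vanishing. The first sum includes the vertices outside [H], of degree 0; the factor 1/2 accounts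
    for ordered pairs. *)
Lemma energy_gap : energy C G - 2 * randic C H =
  \sum_(x | deg H x == 0%N) absmx x x + 2^-1 * \sum_x \sum_y a H x y * edge_gap x y.
Proof.
have -> : \sum_x \sum_y a H x y * edge_gap x y =
    2 * \sum_x \sum_y a H x y * (absmx x x * r H x ^+ 2 * 1)
    - 2 * \sum_x \sum_y a H x y * (r H x * r H y).
  rewrite [2 * \sum_x _]mulr_natl mulr2n.
  (* By symmetry both ends of the edges contribute the same total. *)
  rewrite {2}(sum_adj_sym H (fun x => absmx x x * r H x ^+ 2) (fun=> 1)).
  rewrite mulr_sumr -big_split -sumrB; apply: eq_bigr => x _ /=.
  rewrite mulr_sumr -big_split -sumrB; apply: eq_bigr => y _ /=.
  case xy: (adj H x y); last by rewrite !mul0r mulr0 addr0 subr0.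
  by rewrite !mul1r mulr1 edge_gapE.
rewrite -randicE -mulrBr mulKf ?pnatr_eq0 // addrA; congr (_ - _).
rewrite energy_absmx (bigID (fun x => deg H x == 0%N)) /=; congr (_ + _).
(* A vertex of positive degree recovers all of S_xx, as its degree times [r H x ^+ 2] is 1. *)
rewrite [RHS](bigID (fun x => deg H x == 0%N)) /= [X in _ = X + _]big1 ?add0r.
  apply: eq_bigr => x dx; rewrite -mulr_suml -degE sqr_isqrt_deg mulr1 mulrCA.
  by rewrite mulfV ?mulr1 // pnatr_eq0.
move=> x /eqP dx; rewrite -mulr_suml -degE dx mul0r //.
Qed.

Lemma isolated_sum_ge0 : 0 <= \sum_(x | deg H x == 0%N) absmx x x.
Proof. by apply: sumr_ge0 => x _; apply: absmx_ge0. Qed.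

Lemma edge_gap_ge0 x y : 0 <= a H x y * edge_gap x y.
Proof. by rewrite mulr_ge0 ?ler0n // sumr_ge0 // => i _; apply: edge_gap_term_ge0. Qed.

Lemma edge_gap_sum_ge0 : 0 <= \sum_x \sum_y a H x y * edge_gap x y.
Proof. by apply: sumr_ge0 => x _; apply: sumr_ge0 => y _; apply: edge_gap_ge0. Qed.

Lemma randic_le : 2 * randic C H <= energy C G.
Proof.
rewrite -subr_ge0 energy_gap addr_ge0 ?isolated_sum_ge0 //.
by rewrite mulr_ge0 ?invr_ge0 ?ler0n ?edge_gap_sum_ge0.
Qed.

(** * Consequences of equality *)

Section Equality.
Hypothesis eqE : energy C G = 2 * randic C H.

Lemma gap_terms_eq0 : \sum_(x | deg H x == 0%N) absmx x x = 0 /\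
  \sum_x \sum_y a H x y * edge_gap x y = 0.
Proof.
have /esym/eqP := energy_gap; rewrite eqE subrr paddr_eq0 ?isolated_sum_ge0 //.
  by rewrite mulf_eq0 invr_eq0 pnatr_eq0 /= => /andP[/eqP-> /eqP->].
by rewrite mulr_ge0 ?invr_ge0 ?ler0n ?edge_gap_sum_ge0.
Qed.

(** If [x] were isolated in [H], then S_xx = 0, so every eigenvector of nonzero eigenvalue would
    vanish at [x], and row [x] of A would be zero. *)
Lemma nonisolated x y : adj G x y -> exists x', adj H x' x.
Proof.
move=> xy; case: (set_0Vmem [set z | adj H x z]) => [dx|[z]]; last first.
  by rewrite inE adj_sym; exists z.
have dx0 : deg H x == 0%N by rewrite /deg dx cards0.
have := psumr_eq0P (fun z _ => absmx_ge0 z) gap_terms_eq0.1 dx0.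
rewrite absmx_diag => /(psumr_eq0P (fun i _ => mulr_ge0 (normr_ge0 _) (exprn_ge0 2 (normr_ge0 _)))) px0.
suff: a G x y = 0 by rewrite xy => /eqP; rewrite oner_eq0.
rewrite aG big1 // => i _; have /eqP := px0 i isT.
rewrite mulf_eq0 expf_eq0 /= !normr_eq0 => /orP[]/eqP->; first by rewrite !mul0r.
by rewrite conjC0 mulr0 mul0r.
Qed.

(** This is Au = Sv in eigencoordinates, from the vanishing of each term of [edge_gap]; for
    eigenvalue 0 both sides are 0. *)
Lemma eigenvector_edge x y i : adj H x y ->
  l i * (p i x * r H x) = `|l i| * (p i y * r H y).
Proof.
move=> xy; have gx := psumr_eq0P _ gap_terms_eq0.2.
have {}gx := gx (fun x _ => sumr_ge0 _ (fun y _ => edge_gap_ge0 x y)) x isT.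
have := psumr_eq0P (fun y _ => edge_gap_ge0 x y) gx (i := y) isT.
rewrite xy mul1r => /(psumr_eq0P (fun i _ => edge_gap_term_ge0 x y i))/(_ i isT)/eqP.
rewrite mulf_eq0 expf_eq0 /= invr_eq0 normr_eq0 subr_eq0 normr_eq0.
by case/orP => /eqP // ->; rewrite normr0 !mul0r.
Qed.

Lemma absmx_edge x y z : adj H x y -> a G x z * r H x = absmx y z * r H y.
Proof.
move=> xy; rewrite aG !mulr_suml; apply: eq_bigr => i _.
have /(congr1 Num.conj) := eigenvector_edge i xy.
rewrite !rmorphM /= !isqrt_deg_real conj_normC (conj_Creal (lR i)) => e.
transitivity (l i * ((p i x)^* * r H x) * p i z); first by ring.
by rewrite e; ring.
Qed.

Lemma neigh_edge y' y z : adj H y' y -> adj G y z -> neigh G y' = neigh G z.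
Proof.
move=> y'y yz; have zy := yz; rewrite adj_sym in zy.
have [z' z'z] := nonisolated zy.
have zz' := z'z; rewrite adj_sym in zz'.
have yy' := y'y; rewrite adj_sym in yy'.
have sG u v : adj H u v -> adj G u v by apply: (subsetP subHG.2).
have ry' : r H y' != 0 by rewrite gt_eqF // (isqrt_deg_gt0 y'y).
have rz : r H z != 0 by rewrite gt_eqF // (isqrt_deg_gt0 zz').
(* Both [z] and [y'] are neighbours of [y], so Au = Sv for the edge [yy'] has equal entries
   there. *)
have Sy'z : absmx y' z = absmx y' y'.
  by apply: (mulIf ry'); rewrite -!(absmx_edge _ yy') yz sG.
have Szy' : absmx z y' = absmx y' y'.
  by rewrite -absmx_conj Sy'z absmx_conj.
have Sy'0 : absmx y' y' != 0.
  have := absmx_edge y' yy'; rewrite (sG _ _ yy') mul1r; apply: contra_eqN => /eqP->.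
  by rewrite mul0r gt_eqF // (isqrt_deg_gt0 yy').
(* For the edge [z'z] of [H], S_zy' is nonzero, which forces [z'] and [y'] to be adjacent in [G]. *)
have Szz : absmx z z = absmx y' y'.
  rewrite -Szy'; apply: (mulIf rz); rewrite -!(absmx_edge _ z'z) (sG _ _ z'z).
  case z'y': (adj G z' y') => //; have := absmx_edge y' z'z.
  move/eqP; rewrite z'y' mul0r eq_sym mulf_eq0 (negPf rz) orbF Szy'.
  by rewrite (negPf Sy'0).
(* The quadratic form of S vanishes at e_y' - e_z, so eigenvectors of nonzero eigenvalue agree at
   [y'] and [z]. *)
have /(psumr_eq0P (fun i _ => mulr_ge0 (normr_ge0 _) (exprn_ge0 2 (normr_ge0 _)))) eqp :
    \sum_i `|l i| * `|p i y' - p i z| ^+ 2 = 0.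
  transitivity (absmx y' y' + absmx z z - (absmx y' z + absmx z y')).
    rewrite -!big_split /= -sumrB; apply: eq_bigr => i _.
    by rewrite normCK rmorphB /=; ring.
  by rewrite Szz Sy'z Szy' subrr.
apply/setP => w; rewrite !inE.
suff /eqP : a G y' w = a G z w by rewrite eqr_nat; do 2 case: adj.
rewrite !aG; apply: eq_bigr => i _.
have /eqP := eqp i isT.
rewrite mulf_eq0 expf_eq0 /= !normr_eq0 subr_eq0.
by case/orP=> /eqP->; rewrite ?mul0r.
Qed.

Lemma eq_walk3_closed : walk3_closed G.
Proof.
(* An [H]-neighbour [y'] of [y] has the same [G]-neighbourhood as both [x] and [z]. *)
move=> x y z w xy yz zw; have [y' y'y] := nonisolated yz.
have yx := xy; rewrite adj_sym in yx.
have /setP/(_ w) := etrans (esym (neigh_edge y'y yx)) (neigh_edge y'y yz).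
by rewrite !inE zw.
Qed.

End Equality.

(** * The upper bound for 3-walk closed graphs *)

Hypothesis wG : walk3_closed G.

(** Both sides are the diagonal entry of A^2 at [x]. *)
Lemma sum_eigen_sqr x : \sum_i l i ^+ 2 * `|p i x| ^+ 2 = (deg G x)%:R.
Proof.
transitivity (\sum_z a G x z * a G z x); last first.
  by rewrite degE; apply: eq_bigr => z _; rewrite [adj G z x]adj_sym -natrM mulnb andbb.
under [RHS]eq_bigr => z _ do rewrite [a G z x]aG mulr_sumr.
rewrite exchange_big; apply: eq_bigr => i _ /=.
transitivity (l i * (\sum_z a G x z * p i z)^* * p i x).
  by rewrite eigp rmorphM /= (conj_Creal (lR i)) normCKC expr2; ring.
rewrite rmorph_sum mulr_sumr mulr_suml; apply: eq_bigr => z _.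
by rewrite rmorphM /= conjC_nat; ring.
Qed.

(* A D^-1 A D^-1 A = A *)
Lemma walk3_sum x w :
  \sum_y \sum_z a G x y * a G y z * a G z w / ((deg G y)%:R * (deg G z)%:R) = a G x w.
Proof.
case xw: (adj G x w); last first.
  apply: big1 => y _; apply: big1 => z _.
  case xy: (adj G x y); last by rewrite !mul0r.
  case yz: (adj G y z); last by rewrite mulr0 !mul0r.
  case zw: (adj G z w); last by rewrite mulr0 !mul0r.
  by rewrite (wG xy yz zw) in xw.
have wx := xw; rewrite adj_sym in wx.
(* For [y] adjacent to [x] and [z] to [w], closure makes [yz] an edge and gives deg y = deg w, deg z
   = deg x, so the double sum factors. *)
transitivity (\sum_y \sum_z a G x y / (deg G w)%:R * (a G w z / (deg G x)%:R)).
  apply: eq_bigr => y _; apply: eq_bigr => z _.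
  case xy: (adj G x y); last by rewrite !mul0r.
  rewrite [adj G z w]adj_sym; case wz: (adj G w z); last by rewrite !(mulr0, mul0r).
  have yx := xy; rewrite adj_sym in yx.
  have zw := wz; rewrite adj_sym in zw.
  rewrite (wG yx xw wz) !mul1r invfM.
  by rewrite (walk3_closed_deg wG yx xw) (walk3_closed_deg wG zw wx).
under eq_bigr do rewrite -mulr_sumr -mulr_suml -degE.
rewrite -mulr_suml -mulr_suml -degE.
have dx : (deg G x)%:R != 0 :> C by rewrite pnatr_eq0 -lt0n (deg_gt0 xw).
have dw : (deg G w)%:R != 0 :> C by rewrite pnatr_eq0 -lt0n (deg_gt0 wx).
by rewrite mulrA mulfVK ?mulfV.
Qed.

(** In l = <Ap,p>, replace A by A D^-1 A D^-1 A and let the outer factors A act on p. *)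
Lemma eigenvalue_walk3 i :
  l i = \sum_y \sum_z a G y z * (l i * (p i y)^* / (deg G y)%:R)
                             * (l i * p i z / (deg G z)%:R).
Proof.
have lE : l i = \sum_x \sum_w a G x w * ((p i x)^* * p i w).
  transitivity (\sum_x (p i x)^* * (l i * p i x)).
    rewrite -[LHS]mulr1 -(p1 i) mulr_sumr; apply: eq_bigr => x _.
    by rewrite normCKC mulrCA.
  apply: eq_bigr => x _; rewrite -eigp mulr_sumr; apply: eq_bigr => w _.
  by rewrite mulrCA.
rewrite {1}lE.
transitivity (\sum_x \sum_w \sum_y \sum_z (a G x y * (p i x)^*) * (a G z w * p i w) *
   (a G y z / ((deg G y)%:R * (deg G z)%:R))).
  apply: eq_bigr => x _; apply: eq_bigr => w _.
  rewrite -walk3_sum mulr_suml; apply: eq_bigr => y _.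
  by rewrite mulr_suml; apply: eq_bigr => z _; ring.
under eq_bigr => x _ do rewrite exchange_big.
rewrite exchange_big; apply: eq_bigr => y _.
under eq_bigr => x _ do rewrite exchange_big.
rewrite exchange_big; apply: eq_bigr => z _ /=.
have -> : l i * (p i y)^* = \sum_x a G x y * (p i x)^*.
  rewrite -[l i](conj_Creal (lR i)) -rmorphM -eigp rmorph_sum.
  by apply: eq_bigr => x _; rewrite rmorphM /= conjC_nat adj_sym.
under eq_bigr => x _ do rewrite -mulr_suml -mulr_sumr.
rewrite -!mulr_suml invfM -eigp.
ring.
Qed.

Lemma energy_le : energy C G <= 2 * randic C G.
Proof.
(* Summed over [i], [f i x] is deg x / deg x = 1 at every non-isolated vertex. *)
pose f i x := l i ^+ 2 * `|p i x| ^+ 2 * r G x ^+ 2.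
apply: le_trans (_ : _ <= \sum_i \sum_y \sum_z
    a G y z * (r G y * r G z) * (2^-1 * (f i y + f i z))) _.
  rewrite EG; apply: ler_sum => i _; rewrite {1}eigenvalue_walk3.
  apply: le_trans (ler_norm_sum _ _ _) _; apply: ler_sum => y _.
  apply: le_trans (ler_norm_sum _ _ _) _; apply: ler_sum => z _.
  rewrite !normrM !normfV !normr_nat norm_conjC -!sqr_isqrt_deg -!mulrA.
  rewrite ler_wpM2l ?ler0n //.
  (* One factor [r G y * r G z] is kept as the Randić weight; the rest is a product uv, to be
     bounded by (u^2 + v^2)/2. *)
  have -> : `|l i| * (`|p i y| * (r G y * (r G y * (`|l i| * (`|p i z| * r G z ^+ 2))))) =
    r G y * (r G z * (2^-1 * (2 * ((`|l i| * `|p i y| * r G y) * (`|l i| * `|p i z| * r G z))))).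
    by field.
  rewrite !ler_wpM2l ?isqrt_deg_ge0 ?invr_ge0 ?ler0n // /f.
  rewrite -!(real_normK (lR i)) -!exprMn mulr_natl -subr_ge0.
  set u := _ * r G y; set v := _ * r G z.
  have -> : u ^+ 2 + v ^+ 2 - u * v *+ 2 = (u - v) ^+ 2 by ring.
  by rewrite real_exprn_even_ge0 // rpredB // !rpredM ?normr_real // ger0_real ?isqrt_deg_ge0.
rewrite exchange_big randicE; apply: ler_sum => y _.
rewrite exchange_big; apply: ler_sum => z _ /=.
rewrite -mulr_sumr -mulr_sumr big_split /= -!mulr_suml !sum_eigen_sqr !sqr_isqrt_deg.
case yz: (adj G y z); last by rewrite !mul0r.
have zy := yz; rewrite adj_sym in zy.
rewrite !mulfV ?pnatr_eq0 -?lt0n ?(deg_gt0 yz) ?(deg_gt0 zy) //.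
by rewrite mulVf ?mulr1 // pnatr_eq0.
Qed.

End Decomposition.
End Energy.

Theorem theorem2p6 (C : numClosedFieldType) (T : finType) (G H : graph T)
    (subHG : subgraph H G) :
  2 * randic C H <= energy C G /\
  (energy C G = 2 * randic C H <->
   union_of_complete_bipartite G /\ randic C H = randic C G).
Proof.
have [n [l [p [EG lR aG p1 eigp]]]] := adj_spectral C G.
have subGG : subgraph G G by [].
have leG := randic_le subGG lR EG aG p1.
have two_neq0 : 2 != 0 :> C by rewrite pnatr_eq0.
split; first exact: (randic_le subHG lR EG aG p1).
(* The lower bound for the subgraph [G] of itself meets the upper bound. *)
have eqG : walk3_closed G -> energy C G = 2 * randic C G.
  by move=> wG; apply/le_anti/andP; split=> //; apply: (energy_le lR EG aG p1 eigp wG).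
split=> [eqH|[/union_walk3_closed/eqG-> ->]] //.
have wG := eq_walk3_closed subHG lR EG aG p1 eqH.
split; first exact: walk3_closed_union.
by apply: (mulfI two_neq0); rewrite -eqH eqG.
Qed.
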